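(* Let $n$ be a positive integer, and let $N$ be a proper subcomplex of $M^{(n)}$. Then there exists a (piecewise linear) embedding $f \colon N \to \mathbb{R}^{2n}$ such that ${\rm lk}_2(f(\lambda)) = 0$ for every element $\lambda \in \Lambda^{n-1,n}(N)$.
   Context: Everything is in the piecewise linear category; a simplicial complex is identified with its polyhedron. For a simplicial complex $K$, $\varDelta^{k}(K)$ denotes the set of all $k$-simplices of $K$. Let $\sigma_{m} = |a_{0}a_{1}\cdots a_{m}|$ be an $m$-simplex with vertices $a_0,\ldots,a_m$, regarded as a simplicial $m$-complex; $\sigma_m^k$ denotes its $k$-skeleton. The symbol $*$ denotes join, and finite sets of vertices such as $\{a,b\}$ and $\{a,b,c\}$ are regarded as discrete ($0$-dimensional) complexes. Definition of $M^{(n)}$: let $J=\sigma_{2n}^{n-1}$, the $(n-1)$-skeleton of the $2n$-simplex with vertices $a_0,\ldots,a_{2n}$, and let $a,b,c$ be three distinct vertices not belonging to $J$. Then $M^{(n)}$ is the simplicial $n$-complex $$M^{(n)} = \bigl( J * \{a,b,c\} \bigr) \setminus \{ c * s \mid s \in \varDelta^{n-1}(J) \} = \bigl( J * \{a,b\} \bigr) \cup \bigl\{ c * t \mid t \in \varDelta^{n-2}(J) \bigr\},$$ i.e. the subcomplex of $J*\{a,b,c\}$ obtained by removing all (open) $n$-simplices $|c\, a_{i_0}\cdots a_{i_{n-1}}|$ with $0\le i_0<\cdots<i_{n-1}\le 2n$. Equivalently, it is obtained from $J*\{a,b\}$ by adding all $(n-1)$-simplices $|c\,a_{i_0}\cdots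 a_{i_{n-2}}|$ with $0\le i_0<\cdots<i_{n-2}\le 2n$. For $n=1$, $\varDelta^{-1}(J)$ consists of the empty simplex, so the added simplex is the isolated vertex $c$ and $M^{(1)}$ is the disjoint union of $K_{2,3}$ and a point. For a simplicial complex $K$ and non-negative integers $p,q$, $\Lambda^{p,q}(K)$ is the set of all unordered pairs $\{\gamma,\delta\}$ of mutually disjoint subcomplexes of $K$ with $\gamma$ homeomorphic to the $p$-sphere and $\delta$ homeomorphic to the $q$-sphere. The pair is identified with the disjoint union $\gamma\sqcup\delta$. For $\lambda=\gamma\sqcup\delta\in\Lambda^{p,q}(K)$ and an embedding $f\colon K\to\mathbb{R}^m$ with $m=p+q+1$, $f(\lambda)=f(\gamma)\sqcup f(\delta)$ is a two-component link, and ${\rm lk}_2(f(\lambda))={\rm lk}_2(f(\gamma),f(\delta))\in\mathbb{Z}_2$ is its mod $2$ linking number (the mod $2$ intersection number of one component with a $\mathbb{Z}_2$-chain in general position bounded by the other; for a $0$-sphere, the bounding chain joins its two points). *)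

(* Defs.v *)
From HB Require Import structures.
From mathcomp Require Import all_boot all_order all_algebra.
From mathcomp Require Import boolp classical_sets functions reals.
(* Unqualified [set0], [setT], ... are those of finset. *)
From mathcomp Require Import finset.

Set Implicit Arguments.
Unset Strict Implicit.
Unset Printing Implicit Defensive.

Import Order.TTheory GRing.Theory Num.Theory.

Local Open Scope ring_scope.
Local Open Scope set_scope.

(** Complexes are finite families of finite vertex sets.  The empty simplex
    always belongs to a complex (dimension -1), so that [join] and disjointness
    need no special cases. *)

Definition is_complex (V : finType) (K : {set {set V}}) : Prop :=
  set0 \in K /\ forall s t : {set V}, s \in K -> t \subset s -> t \in K.

Definition subcomplex (V : finType) (L K : {set {set V}}) : Prop :=
  is_complex L /\ L \subset K.

Definition simplices (V : finType) (k : nat) (K : {set {set V}}) :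
  {set {set V}} := [set s in K | #|s| == k.+1].

Definition skeleton (V : finType) (k : nat) (K : {set {set V}}) :
  {set {set V}} := [set s in K | (#|s| <= k.+1)%N].

Definition full_simplex (V : finType) : {set {set V}} := [set: {set V}].

Definition discrete_complex (V : finType) : {set {set V}} :=
  skeleton 0 (full_simplex V).

Definition join (V W : finType) (K : {set {set V}}) (L : {set {set W}}) :
  {set {set (V + W)}} :=
  [set s : {set (V + W)} | ([set v | inl v \in s] \in K) &&
                           ([set w | inr w \in s] \in L)].

(** The vertices a_0, ..., a_2n are [inl i]; the vertices a, b, c are
    [inr 0], [inr 1], [inr 2]. *)

Definition Jcx (n : nat) : {set {set 'I_(2 * n).+1}} :=
  skeleton n.-1 (full_simplex 'I_(2 * n).+1).

Definition vertex_c : 'I_3 := ord_max.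

Definition Mcx (n : nat) : {set {set ('I_(2 * n).+1 + 'I_3)}} :=
  join (Jcx n) (discrete_complex 'I_3)
  :\: [set inr vertex_c |: [set inl i | i in (s : {set 'I_(2 * n).+1})]
        | s in simplices n.-1 (Jcx n)].

(** The boundary of the (p+1)-simplex. *)
Definition sphere (p : nat) : {set {set 'I_p.+2}} :=
  skeleton p (full_simplex 'I_p.+2).

Section PiecewiseLinear.
Variable R : realType.

(** R^V; [R^o] provides the vector space structure. *)
Definition coords (V : finType) := {ffun V -> R^o}.

Definition supp (V : finType) (x : coords V) : {set V} := [set v | x v != 0].

(** The polyhedron of a complex, in barycentric coordinates. *)
Definition polyhedron (V : finType) (K : {set {set V}}) : set (coords V) :=
  [set x : coords V |
    [/\ forall v, 0 <= x v, \sum_v x v = 1 & supp x \in K]]%classic.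

Definition lin_ext (V : finType) (E : lmodType R) (p : V -> E) (x : coords V)
  : E := \sum_v x v *: p v.

(** Injectivity of [lin_ext p] on the polyhedron of [L] says that [p] makes [L]
    a geometric simplicial complex: vertices of a simplex are affinely
    independent, and simplices meet in common faces. *)
Definition subdivision (V W : finType) (K : {set {set V}})
    (L : {set {set W}}) (p : W -> coords V) : Prop :=
  [/\ is_complex L,
      set_bij (polyhedron L) (polyhedron K) (lin_ext p) &
      forall s, s \in L -> exists2 t, t \in K &
        lin_ext p @` polyhedron (powerset s) `<=` polyhedron (powerset t)]%classic.

Definition linear_subdivision (V W : finType) (E : lmodType R)
    (K : {set {set V}}) (f : coords V -> E)
    (L : {set {set W}}) (p : W -> coords V) : Prop :=
  subdivision K L p /\
  forall x, polyhedron L x -> f (lin_ext p x) = lin_ext (f \o p) x.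

(** Maps are total functions, of which only the restriction to the polyhedron
    of [K] matters. *)
Definition PL_map (V : finType) (E : lmodType R) (K : {set {set V}})
    (f : coords V -> E) : Prop :=
  exists (W : finType) (L : {set {set W}}) (p : W -> coords V),
    linear_subdivision K f L p.

Definition PL_embedding (V : finType) (E : lmodType R) (K : {set {set V}})
    (f : coords V -> E) : Prop :=
  PL_map K f /\ set_inj (polyhedron K) f.

(** The inverse of a bijective PL map between compact polyhedra is PL. *)
Definition PL_homeomorphic (V W : finType) (K : {set {set V}})
    (L : {set {set W}}) : Prop :=
  exists g : coords V -> coords W,
    PL_map K g /\ set_bij (polyhedron K) (polyhedron L) g.

(** Pairs are ordered by the dimensions of their components; for p <> q this is
    the same as an unordered pair. *)
Definition Lambda (V : finType) (p q : nat) (K : {set {set V}}) :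
    set ({set {set V}} * {set {set V}}) :=
  [set l | [/\ subcomplex l.1 K, subcomplex l.2 K,
               l.1 :&: l.2 = [set set0]%SET,
               PL_homeomorphic l.1 (sphere p) &
               PL_homeomorphic l.2 (sphere q)]]%classic.

(** A mod 2 chain is a finite set [C] of abstract simplices of the same
    dimension, together with positions of their vertices. *)
Definition boundary2 (X : finType) (C : {set {set X}}) : {set {set X}} :=
  [set t : {set X} |
     odd #|[set s in C | (t \subset s) && (#|s| == #|t|.+1)]|].

Definition geo_simplex (X : finType) (E : lmodType R) (r : X -> E)
    (s : {set X}) : set E := (lin_ext r @` polyhedron (powerset s))%classic.

Definition geo_interior (X : finType) (E : lmodType R) (r : X -> E)
    (s : {set X}) : set E :=
  (lin_ext r @` [set x : coords X | polyhedron (powerset s) x /\ supp x = s])%classic.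

Definition affinely_independent (X : finType) (E : lmodType R) (r : X -> E)
    (s : {set X}) : Prop :=
  set_inj (polyhedron (powerset s)) (lin_ext r).

(** For simplices of complementary dimensions: meeting in at most one point,
    interior to both, amounts to transversality. *)
Definition general_position (X Y : finType) (E : lmodType R)
    (r : X -> E) (s : {set X}) (u : Y -> E) (t : {set Y}) : Prop :=
  (is_subset1 (geo_simplex r s `&` geo_simplex u t) /\
   geo_simplex r s `&` geo_simplex u t
     `<=` geo_interior r s `&` geo_interior u t)%classic.

Definition intersection2 (X Y : finType) (E : lmodType R)
    (r : X -> E) (C : {set {set X}}) (u : Y -> E) (D : {set {set Y}}) : 'F_2 :=
  #|[set st : {set X} * {set Y} | [&& st.1 \in C, st.2 \in D &
      `[< geo_simplex r st.1 `&` geo_simplex u st.2 !=set0 >]%classic]]|%:R.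

(** [C], of dimension p + 1 with vertices at [r], is bounded by the image under
    [f] of the p-sphere [gamma]; [i] identifies the vertices of a subdivision
    of [gamma] with vertices of [C]. *)
Definition bounded_by (V X : finType) (E : lmodType R) (p : nat)
    (f : coords V -> E) (gamma : {set {set V}})
    (C : {set {set X}}) (r : X -> E) : Prop :=
  [/\ forall s, s \in C -> #|s| = p.+2,
      forall s, s \in C -> affinely_independent r s &
      exists (W : finType) (L : {set {set W}}) (v : W -> coords V)
             (i : W -> X),
        [/\ linear_subdivision gamma f L v,
            forall w, [set w]%SET \in L -> r (i w) = f (v w) &
            boundary2 C = [set i @: (t : {set W}) | t in simplices p L]%SET]].

(** [lk2 p q f l e]: the mod 2 linking number of the images under [f] of the
    p-sphere [l.1] and the q-sphere [l.2] is [e].  As usual [e] does not depend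
    on the chain.  This is meaningful for m = p + q + 1 and [f] an embedding. *)
Definition lk2 (V : finType) (m p q : nat) (f : coords V -> 'rV[R]_m)
    (l : {set {set V}} * {set {set V}}) (e : 'F_2) : Prop :=
  exists (X : finType) (C : {set {set X}}) (r : X -> 'rV[R]_m)
         (Y : finType) (D : {set {set Y}}) (u : Y -> coords V),
    [/\ bounded_by p f l.1 C r,
        linear_subdivision l.2 f D u,
        forall s t, s \in C -> t \in simplices q D ->
          general_position r s (f \o u) t &
        e = intersection2 r C (f \o u) (simplices q D)].

End PiecewiseLinear.

(* Main.v *)
Require Import Defs.
From mathcomp Require Import all_boot all_order all_algebra.
From mathcomp Require Import boolp classical_sets functions reals.
From mathcomp Require Import fintype finset zify ring lra.

Set Implicit Arguments.
Unset Strict Implicit.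
Unset Printing Implicit Defensive.

Import Order.TTheory GRing.Theory Num.Theory.

Local Open Scope ring_scope.

(** Write F for the join of the (n-1)-skeleton J of the 2n-simplex with three
    points.  After removing one n-simplex x * s, the complex F embeds linearly
    in R^2n: the vertices of the 2n-simplex are affinely independent, and the
    three remaining points are placed so that in every nontrivial affine dependency in
    which at most n of these vertices and at most one of the three points have
    positive coefficients, and likewise for negative ones, the simplex x * s
    has all its coefficients of the same strict sign.

    If N misses a simplex of M^(n), then x and s can be chosen so that N avoids
    x * s, and so that c * t is different from x * s whenever its boundary is
    contained in N.  On the other hand, every (p-1)-face of a p-simplex in a
    triangulated p-sphere lies in another p-simplex.  Hence an n-sphere in
    M^(n) contains a, b and at least n+1 of the vertices a_i, and a disjoint
    (n-1)-sphere must be the boundary of some c * t.  It bounds the image of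
    c * t, which is disjoint from the image of the n-sphere. *)

(** * Barycentric coordinates and linear extensions *)

Definition vertex_point (R : realType) (V : finType) (v : V) : coords R V :=
  [ffun w => (w == v)%:R].

Lemma lin_extP (R : realType) (V : finType) (E : lmodType R) (p : V -> E) a
    (x y : coords R V) :
  lin_ext p (a *: x + y) = a *: lin_ext p x + lin_ext p y.
Proof.
rewrite /lin_ext scaler_sumr -big_split; apply: eq_bigr => v _ /=.
by rewrite !ffunE scalerDl scalerA.
Qed.

Lemma lin_extD (R : realType) (V : finType) (E : lmodType R) (p : V -> E)
    (x y : coords R V) :
  lin_ext p (x + y) = lin_ext p x + lin_ext p y.
Proof. by have := lin_extP p 1 x y; rewrite !scale1r. Qed.

Lemma lin_ext0 (R : realType) (V : finType) (E : lmodType R) (p : V -> E) :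
  lin_ext p (0 : coords R V) = 0.
Proof. by rewrite /lin_ext big1 // => v _; rewrite ffunE scale0r. Qed.

Lemma lin_extZ (R : realType) (V : finType) (E : lmodType R) (p : V -> E) a
    (x : coords R V) :
  lin_ext p (a *: x) = a *: lin_ext p x.
Proof. by have := lin_extP p a x 0; rewrite lin_ext0 !addr0. Qed.

Lemma lin_extB (R : realType) (V : finType) (E : lmodType R) (p : V -> E)
    (x y : coords R V) :
  lin_ext p (x - y) = lin_ext p x - lin_ext p y.
Proof. by rewrite lin_extD -(scaleN1r y) lin_extZ scaleN1r. Qed.

Lemma lin_ext_vertex (R : realType) (V : finType) (E : lmodType R)
    (p : V -> E) v :
  lin_ext p (vertex_point R v) = p v.
Proof.
rewrite /lin_ext (bigD1 v) //= big1 ?addr0; first by rewrite ffunE eqxx scale1r.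
by move=> w /negPf wv; rewrite ffunE wv scale0r.
Qed.

Lemma lin_ext_vertex_point (R : realType) (V : finType) (x : coords R V) :
  lin_ext (@vertex_point R V) x = x.
Proof.
apply/ffunP => v; rewrite /lin_ext sum_ffunE (bigD1 v) //= big1 ?addr0.
  by rewrite !ffunE eqxx /GRing.scale /= mulr1.
by move=> w /negPf wv; rewrite !ffunE eq_sym wv scaler0.
Qed.

Lemma lin_extE (R : realType) (V W : finType) (p : W -> coords R V)
    (x : coords R W) v :
  lin_ext p x v = \sum_w x w * p w v.
Proof. by rewrite /lin_ext sum_ffunE; apply: eq_bigr => w _; rewrite ffunE. Qed.

Lemma suppP (R : realType) (V : finType) (x : coords R V) (s : {set V}) :
  reflect (forall v, v \notin s -> x v = 0) (supp x \subset s).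
Proof.
apply: (iffP subsetP) => [h v | h v].
  by apply: contraNeq => xv; apply: h; rewrite inE.
by rewrite inE; apply: contraR => /h ->.
Qed.

Lemma polyhedron_powerset (R : realType) (V : finType) (s : {set V})
    (x : coords R V) :
  polyhedron (powerset s) x <->
  [/\ forall v, 0 <= x v, \sum_v x v = 1 & supp x \subset s].
Proof. by rewrite /polyhedron /= inE. Qed.

Lemma polyhedron_face (R : realType) (V : finType) (K : {set {set V}})
    (s : {set V}) (x : coords R V) :
  is_complex K -> s \in K -> polyhedron (powerset s) x -> polyhedron K x.
Proof.
move=> [_ hK] sK /polyhedron_powerset[x0 x1 xs]; split=> //.
exact: hK sK xs.
Qed.

Lemma sum_vertex_point (R : realType) (V : finType) (v : V) :
  \sum_w vertex_point R v w = 1.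
Proof.
rewrite (bigD1 v) //= big1 ?addr0; first by rewrite ffunE eqxx.
by move=> w /negPf wv; rewrite ffunE wv.
Qed.

Lemma vertex_point_polyhedron (R : realType) (V : finType) (s : {set V}) v :
  v \in s -> polyhedron (powerset s) (vertex_point R v).
Proof.
move=> vs; apply/polyhedron_powerset; split.
- by move=> w; rewrite ffunE ler0n.
- exact: sum_vertex_point.
- by apply/suppP => w ws; rewrite ffunE; case: eqP ws vs => // -> /negPf->.
Qed.

Lemma polyhedron_convex (R : realType) (V : finType) (s : {set V}) a
    (x y : coords R V) :
  0 <= a <= 1 -> polyhedron (powerset s) x -> polyhedron (powerset s) y ->
  polyhedron (powerset s) (x + a *: (y - x)).
Proof.
move=> /andP[a0 a1] /polyhedron_powerset[x0 x1 /suppP xs].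
move=> /polyhedron_powerset[y0 y1 /suppP ys].
apply/polyhedron_powerset; split.
- move=> v; rewrite !ffunE /GRing.scale /=.
  have := x0 v; have := y0 v; nra.
- have -> : \sum_v (x + a *: (y - x)) v = \sum_v x v + a * (\sum_v y v - \sum_v x v).
    rewrite -sumrB mulr_sumr -big_split; apply: eq_bigr => v _.
    by rewrite !ffunE.
  by rewrite x1 y1 subrr mulr0 addr0.
- by apply/suppP => v vs; rewrite !ffunE xs ?ys // subrr scaler0 addr0.
Qed.

(** * Linear independence in triangulated polyhedra *)

Lemma kernel_vector (F : fieldType) (V W : finType) (s : {set V}) (t : {set W})
    (a : W -> V -> F) :
  (#|s| < #|t|)%N ->
  exists c : W -> F, [/\ exists2 w, w \in t & c w != 0,
    forall w, w \notin t -> c w = 0 &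
    forall v, v \in s -> \sum_w c w * a w v = 0].
Proof.
move=> st; pose A := \matrix_(i < #|t|, j < #|s|) a (enum_val i) (enum_val j).
have : kermx A != 0.
  rewrite -mxrank_eq0 mxrank_ker -lt0n subn_gt0.
  exact: leq_ltn_trans (rank_leq_col A) st.
move=> /rowV0Pn[u /sub_kermxP uA u0].
(* The kernel row [u], indexed by the enumeration of [t], is extended by zero to all of [W]. *)
pose c w := \sum_(i < #|t|) u 0 i * (enum_val i == w)%:R.
have cE i : c (enum_val i) = u 0 i.
  rewrite /c (bigD1 i) //= big1 ?addr0; first by rewrite eqxx mulr1.
  by move=> j ji; rewrite (inj_eq enum_val_inj) (negPf ji) mulr0.
have c0 w : w \notin t -> c w = 0.
  move=> wt; rewrite /c big1 // => i _; case: eqP => [iw | _]; last by rewrite mulr0.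
  by rewrite -iw enum_valP in wt.
exists c; split=> //.
  case/rV0Pn: u0 => i ui; exists (enum_val i); first exact: enum_valP.
  by rewrite cE.
move=> v vs; have /rowP/(_ (enum_rank_in vs v)) := uA.
rewrite !mxE; apply: etrans; rewrite (bigID (mem t)) /= [X in _ + X]big1 ?addr0.
  2: by move=> w /c0 ->; rewrite mul0r.
rewrite big_enum_val /=; apply: eq_bigr => i _.
by rewrite cE mxE enum_rankK_in.
Qed.

(** Weaker than [subdivision]: simplices of [L] need not lie in simplices of [K]. A PL homeomorphism
    carries a subdivision of its source only to such a triangulation of its target. *)
Definition triangulates (R : realType) (V W : finType) (L : {set {set W}})
    (p : W -> coords R V) (K : {set {set V}}) : Prop :=
  is_complex L /\ set_bij (polyhedron L) (polyhedron K) (lin_ext p).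

Lemma triangulates_vertex (R : realType) (V W : finType) (L : {set {set W}})
    (p : W -> coords R V) (K : {set {set V}}) (s : {set W}) w :
  triangulates L p K -> s \in L -> w \in s -> polyhedron K (p w).
Proof.
move=> [hL [hfun _ _]] sL ws; rewrite -lin_ext_vertex; apply: hfun.
exact: polyhedron_face hL sL (vertex_point_polyhedron R ws).
Qed.

Lemma triangulates_inj (R : realType) (V W : finType) (L : {set {set W}})
    (p : W -> coords R V) (K : {set {set V}}) (x y : coords R W) :
  triangulates L p K -> polyhedron L x -> polyhedron L y ->
  lin_ext p x = lin_ext p y -> x = y.
Proof. by move=> [_ [_ hinj _]] xL yL; apply: hinj; apply: mem_set. Qed.

Lemma sum_lin_ext (R : realType) (V W : finType) (L : {set {set W}})
    (p : W -> coords R V) (K : {set {set V}}) (s : {set W}) (c : coords R W) :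
  triangulates L p K -> s \in L -> supp c \subset s ->
  \sum_v lin_ext p c v = \sum_w c w.
Proof.
move=> hT sL /suppP cs; under eq_bigr do rewrite lin_extE.
rewrite exchange_big; apply: eq_bigr => w _ /=; rewrite -mulr_sumr.
have [ws | /cs ->] := boolP (w \in s); last by rewrite mul0r.
by have [_ -> _] := triangulates_vertex hT sL ws; rewrite mulr1.
Qed.

(** The points [p w] have coordinate sum 1, so a linear dependency has coefficient sum 0. Adding a
    small multiple of it to the barycenter of [s] would not change the image, against
    injectivity. *)
Lemma triangulates_indep (R : realType) (V W : finType) (L : {set {set W}})
    (p : W -> coords R V) (K : {set {set V}}) (s : {set W}) (c : coords R W) :
  triangulates L p K -> s \in L -> supp c \subset s -> lin_ext p c = 0 -> c = 0.
Proof.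
move=> hT sL cs pc0; have [hL _] := hT.
have c1 : \sum_w c w = 0.
  by rewrite -(sum_lin_ext hT sL cs) pc0 big1 // => v _; rewrite ffunE.
apply/eqP; apply: contraT => cn0.
have s0 : (0 < #|s|)%N.
  rewrite lt0n cards_eq0; apply: contraNneq cn0 => s0.
  move: cs; rewrite s0 => /suppP cs; apply/eqP/ffunP => v; rewrite ffunE.
  by apply: cs; rewrite inE.
have sR : 0 < #|s|%:R :> R by rewrite ltr0n.
(* [b] is the barycenter of [s]. Every [c w] is at least [- M], and [e * M] is the coordinate of [b]
   on [s], so [b + e *: c] has no negative coordinate. *)
pose b : coords R W := [ffun w => (w \in s)%:R / #|s|%:R].
pose M := \sum_w `|c w| + 1.
have M0 : 0 < M by rewrite ltr_wpDl ?ltr01 // sumr_ge0.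
have cM w : - M <= c w.
  rewrite lerNl; apply: (le_trans (ler_norm _)); rewrite normrN /M (bigD1 w) //=.
  by rewrite -addrA lerDl addr_ge0 ?ler01 // sumr_ge0.
pose e := (#|s|%:R * M)^-1.
have e0 : 0 < e by rewrite invr_gt0 mulr_gt0.
have bs : polyhedron (powerset s) b.
  apply/polyhedron_powerset; split.
  - by move=> v; rewrite ffunE divr_ge0 ?ler0n.
  - under eq_bigr do rewrite ffunE.
    have sE : (\sum_v (v \in s))%N = #|s|.
      by rewrite -sum1_card [RHS]big_mkcond; apply: eq_bigr => v _; case: (v \in s).
    by rewrite -mulr_suml -natr_sum sE divff ?gt_eqF.
  - by apply/suppP => v /negPf vs; rewrite ffunE vs mul0r.
have ys : polyhedron (powerset s) (b + e *: c).
  apply/polyhedron_powerset; have [_ b1 /suppP b2] := (polyhedron_powerset s b).1 bs.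
  split.
  - move=> v; rewrite !ffunE /GRing.scale /=.
    have [vs | vs] := boolP (v \in s); last first.
      by rewrite (suppP _ _ cs) // mulr0 addr0 mul0r.
    have -> : true%:R / #|s|%:R = e * M :> R.
      by rewrite /e invfM -mulrA mulVf ?gt_eqF // mulr1 mul1r.
    by rewrite -mulrDr mulr_ge0 ?(ltW e0) // addrC -lerBlDr sub0r.
  - transitivity (\sum_v b v + e * \sum_v c v); last by rewrite b1 c1 mulr0 addr0.
    by rewrite mulr_sumr -big_split; apply: eq_bigr => v _; rewrite !ffunE.
  - apply/suppP => v vs; rewrite !ffunE (suppP _ _ cs) // scaler0 addr0.
    by rewrite (negPf vs) mul0r.
have : b + e *: c = b.
  apply: (triangulates_inj hT); try exact: polyhedron_face hL sL _.
  by rewrite lin_extD lin_extZ pc0 scaler0 addr0.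
move/(congr1 (fun z => z - b)); rewrite addrC addKr subrr => /eqP.
by rewrite scaler_eq0 gt_eqF //= (negPf cn0).
Qed.

(** The vertices of [s] are linearly independent vectors in the coordinate space of [t]. *)
Lemma triangulates_card (R : realType) (V W : finType) (L : {set {set W}})
    (p : W -> coords R V) (K : {set {set V}}) (s : {set W}) (t : {set V}) :
  triangulates L p K -> s \in L -> (forall w, w \in s -> supp (p w) \subset t) ->
  (#|s| <= #|t|)%N.
Proof.
move=> hT sL st; rewrite leqNgt; apply/negP => ts.
have [c [[w ws cw] cs c0]] := kernel_vector (fun w v => p w v) ts.
pose C : coords R W := [ffun w => c w].
have : C = 0.
  apply: (triangulates_indep hT sL).
    by apply/suppP => u us; rewrite ffunE cs.
  apply/ffunP => v; rewrite lin_extE ffunE; under eq_bigr do rewrite ffunE.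
  have [/c0 // | vt] := boolP (v \in t).
  apply: big1 => u _; have [us | /cs ->] := boolP (u \in s); last by rewrite mul0r.
  by have /suppP -> := st u us; rewrite ?mulr0.
by move/ffunP/(_ w); rewrite !ffunE => cw0; rewrite cw0 eqxx in cw.
Qed.

(** By a count of dimensions, the vertices of [s] form a basis of the coordinate space of [t]. *)
Lemma triangulates_span (R : realType) (V W : finType) (L : {set {set W}})
    (p : W -> coords R V) (K : {set {set V}}) (s : {set W}) (t : {set V})
    (z : coords R V) :
  triangulates L p K -> s \in L -> (forall w, w \in s -> supp (p w) \subset t) ->
  (#|t| <= #|s|)%N -> supp z \subset t ->
  exists c : coords R W, supp c \subset s /\ lin_ext p c = z.
Proof.
move=> hT sL st ts zt.
(* The extra index [None] stands for [z]. A dependency among these vectors must involve [z], since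
   the vertices of [s] alone are independent. *)
pose S : {set option W} := None |: [set Some w | w in s].
have cS : (#|t| < #|S|)%N.
  rewrite cardsU1 card_imset; last exact: Some_inj.
  by case: imsetP => [[? _ //] | _]; rewrite add1n ltnS.
pose a (o : option W) v := if o is Some w then p w v else z v.
have [c [[o oS co] cS0 c0]] := kernel_vector a cS.
pose C : coords R W := [ffun w => c (Some w)].
have Cs : supp C \subset s.
  apply/suppP => w ws; rewrite ffunE; apply: cS0; rewrite !inE /=.
  by rewrite mem_imset //; exact: Some_inj.
have E : lin_ext p C = - c None *: z.
  apply/ffunP => v; rewrite lin_extE !ffunE.
  have [vt | vt] := boolP (v \in t).
    have := c0 v vt; rewrite (bigD1 None) //= => /eqP; rewrite addrC addr_eq0.
    move=> /eqP; rewrite /GRing.scale /= mulNr => <-.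
    rewrite (reindex_omap Some id) /=; last by case.
    by apply: eq_big => [w | w _]; rewrite ?eqxx ?ffunE.
  rewrite (suppP _ _ zt) // scaler0; apply: big1 => u _; rewrite ffunE.
  have [us | us] := boolP (u \in s); last first.
    by rewrite cS0 ?mul0r // !inE /= mem_imset //; exact: Some_inj.
  by have /suppP -> := st u us; rewrite ?mulr0.
have cN : c None != 0.
  apply: contra_neq co => cN; move: E; rewrite cN oppr0 scale0r.
  move/(triangulates_indep hT sL Cs)/ffunP => C0.
  by case: o {oS} => [w | //]; have := C0 w; rewrite !ffunE.
exists (- (c None)^-1 *: C); split.
  by apply/suppP => w ws; rewrite ffunE (suppP _ _ Cs) // scaler0.
by rewrite lin_extZ E scalerA mulrNN mulVf // scale1r.
Qed.

(** * Generic points and rays *)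

Lemma exists_pos_nonroot (R : realType) (P : {poly R}) :
  P != 0 -> exists2 e, 0 < e & P.[e] != 0.
Proof.
move=> P0; pose rs : seq R := [seq i.+1%:R | i <- iota 0 (size P)].
have rsU : uniq rs.
  by rewrite map_inj_uniq ?iota_uniq // => i j /eqP; rewrite eqr_nat => /eqP[].
have : ~~ all (root P) rs.
  apply/negP => /(max_poly_roots P0)/(_ rsU).
  by rewrite size_map size_iota ltnn.
by case/allPn => _ /mapP[i _ ->] ?; exists i.+1%:R; rewrite ?ltr0n.
Qed.

(* The coordinates of the point are successive powers of a number that avoids
   the roots of finitely many polynomials, one for each simplex of too small
   dimension. *)
Lemma exists_generic_point (R : realType) (V W : finType) (p : W -> coords R V)
    (s : {set V}) :
  s != set0 ->
  exists x : coords R V, [/\ polyhedron (powerset s) x, supp x = s &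
    forall y : coords R W, lin_ext p y = x -> (#|s| <= #|supp y|)%N].
Proof.
move=> s0.
have /choice[P HP] (r : {set W}) : exists Q : {poly R}, Q != 0 /\
    ((#|r| < #|s|)%N -> forall (y : coords R W) e a, a != 0 -> supp y \subset r ->
     (forall v, v \in s -> lin_ext p y v = a * e ^+ enum_rank v) -> Q.[e] = 0).
  have [rs | ] := boolP (#|r| < #|s|)%N; last first.
    by exists 1; split; [exact: oner_neq0|].
  (* [c] is a nonzero linear form on the coordinates in [s] that vanishes on every [p w] with [w] in
     [r]; its value on successive powers is the polynomial. The factor [a] will be the normalising
     constant [S^-1]. *)
  have [c [[v vs cv] cs c0]] := kernel_vector (fun v w => p w v) rs.
  exists (\sum_v c v *: 'X^(enum_rank v)); split.
    apply: contra_neq cv => /(congr1 (fun q : {poly R} => q`_(enum_rank v))).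
    rewrite coef0 coef_sum (bigD1 v) //= big1 ?addr0.
      by rewrite coefZ coefXn eqxx mulr1.
    move=> w wv; rewrite coefZ coefXn (inj_eq val_inj) (inj_eq enum_rank_inj).
    by rewrite eq_sym (negPf wv) mulr0.
  move=> _ y e a a0 /suppP yr ys; rewrite horner_sum.
  apply: (mulfI a0); rewrite mulr0 mulr_sumr.
  transitivity (\sum_v c v * lin_ext p y v).
    apply: eq_bigr => w _; rewrite hornerZ hornerXn.
    by have [/ys -> | /cs ->] := boolP (w \in s); [rewrite mulrCA | rewrite !mul0r mulr0].
  under eq_bigr do rewrite lin_extE mulr_sumr.
  rewrite exchange_big /=; apply: big1 => w _.
  have [/c0 cw | /yr ->] := boolP (w \in r); last by apply: big1 => ? _; rewrite mul0r mulr0.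
  by under eq_bigr do rewrite mulrCA; rewrite -mulr_sumr cw mulr0.
have : \prod_r P r != 0 by apply/prodf_neq0 => r _; case: (HP r).
case/exists_pos_nonroot => e e0; rewrite horner_prod => /prodf_neq0 Pe.
pose S := \sum_(v in s) e ^+ enum_rank v.
have S0 : 0 < S.
  have /set0Pn[v vs] := s0; rewrite /S (bigD1 v) //= ltr_pwDl ?exprn_gt0 //.
  by apply: sumr_ge0 => w _; rewrite exprn_ge0 // ltW.
pose x : coords R V := [ffun v => if v \in s then S^-1 * e ^+ enum_rank v else 0].
have xs : supp x = s.
  apply/setP => v; rewrite inE ffunE; case: ifP => _; last by rewrite eqxx.
  by rewrite mulf_neq0 ?expf_neq0 ?invr_neq0 ?gt_eqF.
exists x; split=> //.
  apply/polyhedron_powerset; split; last by rewrite xs.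
    move=> v; rewrite ffunE; case: ifP => // _.
    by rewrite mulr_ge0 ?invr_ge0 ?exprn_ge0 // ltW.
  under eq_bigr do rewrite ffunE.
  by rewrite -big_mkcond -mulr_sumr mulVf // gt_eqF.
move=> y yx; rewrite leqNgt; apply/negP => ys.
have [_ /(_ ys y e S^-1)] := HP (supp y).
move/(_ _ (subxx _)) => Q; have := Pe (supp y) isT; rewrite Q ?eqxx ?invr_neq0 ?gt_eqF //.
by move=> v vs; rewrite yx ffunE vs.
Qed.

Lemma small_step (R : realType) (V : finType) (x d : V -> R) :
  exists2 a, 0 < a & forall e v, 0 < e < a -> 0 < x v -> 0 < x v + e * d v.
Proof.
pose a := \big[Num.min/1]_(v | 0 < x v) (x v / (`|d v| + 1)).
have d0 v : 0 < `|d v| + 1 by rewrite ltr_wpDl.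
exists a.
  by apply/bigmin_gtP; split=> // v xv; rewrite divr_gt0.
move=> e v /andP[e0 ea] xv.
have : e < x v / (`|d v| + 1).
  by apply: (lt_le_trans ea); exact: bigmin_le_cond.
rewrite ltr_pdivlMr // => ed.
have := ler_norm (- d v); rewrite normrN => dv; nra.
Qed.

(** One of the finitely many simplices contains points over the ray arbitrarily close to its origin
    and, being closed, contains a point over the origin too. *)
Lemma ray_simplex (R : realType) (V W : finType) (L : {set {set W}})
    (p : W -> coords R V) (K : {set {set V}}) (z d : coords R V) a :
  triangulates L p K -> 0 < a ->
  (forall e, 0 < e < a -> polyhedron K (z + e *: d)) ->
  exists s x y e, [/\ s \in L, polyhedron (powerset s) x, polyhedron (powerset s) y,
    lin_ext p x = z & 0 < e /\ lin_ext p y = z + e *: d].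
Proof.
move=> hT a0 hz; have [hL [_ _ hsurj]] := hT.
(* Otherwise each simplex [s] misses the ray below some bound [b s], and half the minimum of these
   bounds gives a point of the ray that no simplex covers. *)
have [s [sL hs]] : exists s, s \in L /\ forall b, 0 < b ->
    exists e y, [/\ 0 < e, e < a, e < b, polyhedron (powerset s) y &
                    lin_ext p y = z + e *: d].
  apply: contrapT => hn.
  have /choice[b hb] (s : {set W}) : exists b, 0 < b /\ (s \in L -> forall e y,
      0 < e -> e < a -> e < b -> polyhedron (powerset s) y ->
      lin_ext p y <> z + e *: d).
    apply: contrapT => hs; apply: hn; exists s; split.
      by apply: contrapT => sL; apply: hs; exists 1; split.
    move=> b b0; apply: contrapT => hb; apply: hs; exists b; split=> // sL e y *.
    by move=> ye; apply: hb; exists e, y.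
  pose m := \big[Num.min/a]_s b s.
  have m0 : 0 < m by apply/bigmin_gtP; split=> // s _; case: (hb s).
  have ma : m <= a by exact: bigmin_le_id.
  have m2 : 0 < m / 2 by rewrite divr_gt0.
  have m2m : m / 2 < m by lra.
  have [|y yL yz] := hsurj (z + (m / 2) *: d).
    by apply: hz; rewrite m2; lra.
  have [_ yE] := hb (supp y); have [y0 y1 yS] := yL.
  apply: (yE yS (m / 2) y) yz => //; first by lra.
    by apply: lt_le_trans m2m _; apply: bigmin_le.
  exact/polyhedron_powerset.
have [e1 [y1 [e1p e1a _ y1s y1z]]] := hs a a0.
have [e2 [y2 [e2p e2a e21 y2s y2z]]] := hs e1 e1p.
have e12 : e2 - e1 != 0 by rewrite lt_eqF // subr_lt0.
(* Affine extrapolation through [y1] and [y2]; [y 0] is the candidate over the origin [z]. *)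
pose y e := y1 + ((e - e1) / (e2 - e1)) *: (y2 - y1).
have yz e : lin_ext p (y e) = z + e *: d.
  rewrite lin_extD lin_extZ lin_extB y1z y2z opprD addrACA subrr add0r.
  by rewrite -scalerBl scalerA divfK // -addrA -scalerDl (addrC e1) subrK.
have [_ y1S y1u] := (polyhedron_powerset s y1).1 y1s.
have [_ y2S y2u] := (polyhedron_powerset s y2).1 y2s.
have yu e : supp (y e) \subset s.
  apply/suppP => w ws; rewrite !ffunE (suppP _ _ y1u) // (suppP _ _ y2u) //.
  by rewrite subrr scaler0 addr0.
have yl e w : y e w = y 0 w + e * ((y2 w - y1 w) / (e2 - e1)).
  by rewrite /y !ffunE /GRing.scale /=; field.
exists s, (y 0), y1, e1; split=> //; last by rewrite yz scale0r addr0.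
have y_sum : \sum_w y 0 w = 1.
    transitivity (\sum_w y1 w + (0 - e1) / (e2 - e1) * (\sum_w y2 w - \sum_w y1 w)).
    rewrite -sumrB mulr_sumr -big_split; apply: eq_bigr => w _.
    by rewrite !ffunE.
  by rewrite y1S y2S subrr mulr0 addr0.
apply/polyhedron_powerset; split=> // w.
(* A negative coordinate of [y 0] would stay negative in [y e] for small [e], in view of the slope
   [k]; but for some such [e] independence identifies [y e] with a point [y3] of the simplex. *)
rewrite leNgt; apply/negP => yw.
pose k := (y2 w - y1 w) / (e2 - e1).
have k0 : 0 < `|k| + 1 by rewrite ltr_wpDl.
have [|e [y3 [e0 _ eb y3s y3z]]] := hs (- y 0 w / (`|k| + 1)).
  by rewrite divr_gt0 // oppr_gt0.
have y3E : y3 = y e.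
  have [_ _ y3u] := (polyhedron_powerset s y3).1 y3s.
  apply/subr0_eq/(triangulates_indep hT sL).
    apply/suppP => u us; transitivity (y3 u - y e u); first by rewrite !ffunE.
    by rewrite (suppP _ _ y3u) // (suppP _ _ (yu e)) // subrr.
  by rewrite lin_extB y3z yz subrr.
have [/(_ w) + _ _] := (polyhedron_powerset s y3).1 y3s.
rewrite y3E yl -/k; move: eb; rewrite ltr_pdivlMr // => eb.
have := ler_norm k; nra.
Qed.

(** * Triangulated PL spheres *)

Lemma exists_subset_card (V : finType) (s : {set V}) k :
  (k <= #|s|)%N -> exists2 t : {set V}, t \subset s & #|t| = k.
Proof.
move=> ks; exists [set v in take k (enum s)].
  by apply/subsetP => v; rewrite inE => /mem_take; rewrite mem_enum.
by rewrite cardsE (card_uniqP _) ?take_uniq ?enum_uniq // size_takel // -cardE.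
Qed.

Lemma sphere_polyhedron (R : realType) p (x : coords R 'I_p.+2) u :
  (forall v, 0 <= x v) -> \sum_v x v = 1 -> x u = 0 -> polyhedron (sphere p) x.
Proof.
move=> x0 x1 xu; split=> //; rewrite !inE /=.
have /subset_leq_card : supp x \subset [set~ u].
  by apply/suppP => v; rewrite !inE negbK => /eqP->.
by rewrite cardsC1 card_ord.
Qed.

Lemma sphere_coord0 (R : realType) p (x : coords R 'I_p.+2) :
  polyhedron (sphere p) x -> exists u, x u = 0.
Proof.
move=> [_ _]; rewrite !inE /= => xp.
have /set0Pn[u] : ~: supp x != set0.
  by rewrite -card_gt0 cardsCs setCK card_ord subn_gt0.
by rewrite !inE negbK => /eqP; exists u.
Qed.

(** [lin_ext p x v] is a sum of nonnegative terms, because the vertices of the simplex lie in the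
    polyhedron; if it vanishes, so does each term. *)
Lemma triangulates_coord0 (R : realType) (V W : finType) (L : {set {set W}})
    (p : W -> coords R V) (K : {set {set V}}) (x : coords R W) v w :
  triangulates L p K -> polyhedron L x -> lin_ext p x v = 0 -> w \in supp x ->
  p w v = 0.
Proof.
move=> hT [x0 _ xL]; rewrite lin_extE => /eqP; rewrite psumr_eq0; last first.
  move=> u _; have [-> | xu] := eqVneq (x u) 0; first by rewrite mul0r.
  have us : u \in supp x by rewrite inE.
  by have [p0 _ _] := triangulates_vertex hT xL us; rewrite mulr_ge0.
move=> /allP/(_ w); rewrite mem_index_enum inE => /(_ isT) /=.
by rewrite mulf_eq0 => /orP[-> // | /eqP].
Qed.

(** A subdivision of [K] on which the homeomorphism is linear triangulates both polyhedra; only on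
    the side of [K] are its simplices known to lie in simplices. *)
Lemma PL_homeomorphic_triangulates (R : realType) (V W : finType)
    (K : {set {set V}}) (M : {set {set W}}) :
  PL_homeomorphic R K M ->
  exists (X : finType) (L : {set {set X}}) (p : X -> coords R V)
      (q : X -> coords R W),
    [/\ triangulates L p K, triangulates L q M &
      forall s, s \in L -> exists2 t, t \in K &
        forall x, x \in s -> supp (p x) \subset t].
Proof.
move=> [g [[X [L [p [[hL hp hs] hg]]]] [gfun ginj gsurj]]].
have [pfun pinj psurj] := hp.
exists X, L, p, (g \o p); split.
- by split.
- split=> //; split.
  + by move=> x xL; rewrite -hg //; apply/gfun/pfun.
  + move=> x y /set_mem xL /set_mem yL; rewrite -!hg //.
    move/(ginj _ _ (mem_set (pfun _ xL)) (mem_set (pfun _ yL))).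
    by apply: pinj; apply: mem_set.
  + move=> z /gsurj[y yK <-]; have [x xL <-] := psurj y yK.
    by exists x => //; rewrite hg.
- move=> s /hs[t tK st]; exists t => // x xs.
  suff /polyhedron_powerset[_ _] : polyhedron (powerset t) (p x) by [].
  by apply: st; exists (vertex_point R x); rewrite ?lin_ext_vertex //; apply: vertex_point_polyhedron.
Qed.

Lemma supp_triangulates (R : realType) (V W : finType) (p : W -> coords R V)
    (x : coords R W) (t : {set V}) :
  (forall w, w \in supp x -> supp (p w) \subset t) -> supp (lin_ext p x) \subset t.
Proof.
move=> h; apply/suppP => v vt; rewrite lin_extE big1 // => w _.
have [-> | xw] := eqVneq (x w) 0; first by rewrite mul0r.
by rewrite (suppP _ _ (h w _)) ?mulr0 // inE.
Qed.

(** A generic point of a facet of the standard sphere lies in a simplex of the triangulation with at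
    least [p.+1] vertices, and a simplex of [K] containing that one has at least as many. *)
Lemma PL_sphere_top_simplex (R : realType) (V : finType) (K : {set {set V}}) p :
  is_complex K -> PL_homeomorphic R K (sphere p) ->
  exists2 s, s \in K & #|s| = p.+1.
Proof.
move=> [_ hK] /PL_homeomorphic_triangulates[X [L [P [Q [hP hQ hs]]]]].
have F0 : [set~ ord0] != set0 :> {set 'I_p.+2}.
  by rewrite -card_gt0 cardsC1 card_ord.
have [x [/polyhedron_powerset[x0 x1 xs] _ xgen]] := exists_generic_point Q F0.
have xS : polyhedron (sphere p) x.
  apply: (@sphere_polyhedron _ _ _ ord0) => //.
  by apply: (suppP _ _ xs); rewrite !inE eqxx.
have [_ [_ _ hsurj]] := hQ; have [y yL /xgen] := hsurj _ xS.
rewrite cardsC1 card_ord /= => py.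
have [_ _ yK] := yL; have [t tK yt] := hs _ yK.
have pt : (p.+1 <= #|t|)%N := leq_trans py (triangulates_card hP yK yt).
by have [s st sp] := exists_subset_card pt; exists s => //; apply: hK tK st.
Qed.

(* Near a generic point [x] of a free face, [K] is a half-disc, covered by one
   simplex [r'] of the common subdivision; in the sphere one can leave [r']
   through the image of [x], either along the facet containing the image of
   [r'] or into another facet. *)
Lemma PL_sphere_no_free_face (R : realType) (V : finType) (K : {set {set V}}) p
    (s : {set V}) v :
  is_complex K -> PL_homeomorphic R K (sphere p) ->
  s \in K -> #|s| = p.+1 -> v \in s ->
  exists2 w, w \notin s & w |: s :\ v \in K.
Proof.
move=> hK hS sK sp vs; apply: contrapT => hfree.
have [K0 Kd] := hK.
have {hfree} free r : r \in K -> s :\ v \subset r -> r \subset s.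
  move=> rK tr; apply/subsetP => w wr; apply: contrapT => /negP ws.
  by apply: hfree; exists w => //; apply: Kd rK _; rewrite subUset sub1set wr.
have tp : #|s :\ v| = p by have := cardsD1 v s; rewrite vs sp add1n => -[].
have [X [L [P [Q [hP hQ hs]]]]] := PL_homeomorphic_triangulates hS.
have [hL [Pfun Pinj Psurj]] := hP; have [_ [Qfun _ Qsurj]] := hQ.
(* If [s] is the single vertex [v], freeness makes the polyhedron of [K] a point, while the sphere
   contains two distinct vertices. *)
have [t0 | tn0] := eqVneq (s :\ v) set0.
  have K1 r : r \in K -> r \subset [set v].
    move=> rK; apply: subset_trans (free r rK _) _; first by rewrite t0 sub0set.
    by rewrite -(setD1K vs) t0 setU0.
  have x1 x : polyhedron K x -> x = vertex_point R v.
    move=> [_ xS /K1 xv]; apply/ffunP => w; rewrite ffunE.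
    case: eqP => [-> | /eqP wv]; last by apply: (suppP _ _ xv); rewrite inE.
    rewrite -xS (bigD1 v) //= big1 ?addr0 // => u uv.
    by apply: (suppP _ _ xv); rewrite inE.
  have [g [_ [gfun ginj gsurj]]] := hS.
  have hv i : polyhedron (sphere p) (vertex_point R (i : 'I_p.+2)).
    have [j ji] : exists j : 'I_p.+2, j != i.
      by exists (if i == ord0 then ord_max else ord0); case: (eqVneq i ord0) => [->|]; rewrite // eq_sym.
    apply: (@sphere_polyhedron _ _ _ j).
    - by move=> w; rewrite ffunE ler0n.
    - exact: sum_vertex_point.
    - by rewrite ffunE (negPf ji).
  have [a /x1 -> ga] := gsurj _ (hv ord0); have [b /x1 -> gb] := gsurj _ (hv ord_max).
  move: gb; rewrite ga => /ffunP/(_ ord0)/eqP; rewrite !ffunE eqxx.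
  by rewrite -[ord0 == _]/false oner_eq0.
have [x [xt xsupp xgen]] := exists_generic_point P tn0.
have xv : x v = 0.
  have : v \notin supp x by rewrite xsupp !inE eqxx.
  by rewrite inE negbK => /eqP.
have ts : s :\ v \subset s by exact: subsetDl.
have xs : polyhedron (powerset s) x.
  apply/polyhedron_powerset; have [x0 x1 xu] := (polyhedron_powerset _ x).1 xt.
  by split=> //; apply: subset_trans xu ts.
(* The segment from [x] towards [v] stays in [s]; [r] is a simplex of the triangulation containing
   its beginning. *)
have [r [y0 [y1 [e [rL y0r y1r y0x [e0 y1x]]]]]] : exists r (y0 y1 : coords R X) e,
    [/\ r \in L, polyhedron (powerset r) y0, polyhedron (powerset r) y1,
    lin_ext P y0 = x & 0 < e /\ lin_ext P y1 = x + e *: (vertex_point R v - x)].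
  apply: (ray_simplex hP ltr01) => e /andP[e0 e1].
  apply: polyhedron_face hK sK _; apply: polyhedron_convex => //.
    by rewrite !ltW.
  exact: vertex_point_polyhedron.
have y0L : polyhedron L y0 := polyhedron_face hL rL y0r.
have [y00 y0S y0u] := (polyhedron_powerset _ _).1 y0r.
have Pt w : w \in supp y0 -> supp (P w) \subset s :\ v.
  move=> wy; apply/suppP => u ut; apply: (triangulates_coord0 hP y0L _ wy).
  by rewrite y0x; apply/eqP; apply: negbNE; rewrite -xsupp inE in ut.
(* A simplex of [K] containing [supp x], which is [s :\ v], lies in [s] by freeness. *)
have star r' : r' \in L -> supp y0 \subset r' -> forall w, w \in r' -> supp (P w) \subset s.
  move=> r'L y0r' w wr'; have [k kK r'k] := hs r' r'L.
  apply: subset_trans (r'k w wr') _; apply: free => //.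
  rewrite -xsupp -y0x; apply: supp_triangulates => u uy.
  exact/r'k/(subsetP y0r').
have [w wr wv] : exists2 w, w \in r & 0 < P w v.
  have : 0 < lin_ext P y1 v.
    by rewrite y1x !ffunE xv eqxx /GRing.scale /= subr0 mulr1 add0r.
  rewrite lt0r => /andP[+ _]; apply: contraNP => hn; apply/eqP.
  rewrite lin_extE; apply: big1 => w _; have [_ _ y1u] := (polyhedron_powerset _ _).1 y1r.
  have [wr | /(suppP _ _ y1u) ->] := boolP (w \in r); last by rewrite mul0r.
  have [Pw0 _ _] := triangulates_vertex hP rL wr.
  have [-> | Pw] := eqVneq (P w v) 0; first by rewrite mulr0.
  by case: hn; exists w => //; rewrite lt0r Pw Pw0.
have wy : w \notin supp y0.
  apply: contraTN wv => /Pt/suppP/(_ v) ->; first by rewrite ltxx.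
  by rewrite !inE eqxx.
have y0w : y0 w = 0 by move: wy; rewrite inE negbK => /eqP.
(* By genericity of [x], [supp y0] has at least [p] elements, so [r'] has at least as many vertices
   as [s], and they span the coordinate space of [s]. *)
pose r' := w |: supp y0.
have r'L : r' \in L by have [_ Ld] := hL; apply: Ld rL _; rewrite subUset sub1set wr.
have yr' : supp y0 \subset r' by exact: subsetUr.
have y0r' : polyhedron (powerset r') y0 by apply/polyhedron_powerset.
have r's : (#|s| <= #|r'|)%N.
  by rewrite cardsU1 wy sp add1n ltnS -tp; apply: xgen.
(* The displacement from [x] to the image of [y] is a combination [c] of vertices of [r']. Its
   coefficient at [w] is nonnegative because the coordinate at [v] is, so a small step from [y0]
   along [c] stays in [r']. It has the same image as a step towards [y], hence [c] is [y - y0] by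
   injectivity. *)
have local q (y : coords R X) : q \in L -> supp y0 \subset q -> polyhedron (powerset q) y ->
    supp y \subset r'.
  move=> qL y0q yq; have [_ yS yu] := (polyhedron_powerset _ _).1 yq.
  have yL := polyhedron_face hL qL yq.
  have Pys : supp (lin_ext P y) \subset s.
    by apply: supp_triangulates => u uy; apply: (star q) => //; apply: (subsetP yu).
  have [_ _ xu] := (polyhedron_powerset _ _).1 xs.
  have zs : supp (lin_ext P y - x) \subset s.
    apply/suppP => u us; transitivity (lin_ext P y u - x u); first by rewrite !ffunE.
    by rewrite (suppP _ _ Pys) // (suppP _ _ xu) // subrr.
  have [c [cr cz]] := triangulates_span hP r'L (star r' r'L yr') r's zs.
  have c1 : \sum_u c u = 0.
    rewrite -(sum_lin_ext hP r'L cr) cz.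
    have [_ PyS _] := Pfun _ yL; have [_ xS _] := (polyhedron_powerset _ _).1 xs.
    transitivity (\sum_u lin_ext P y u - \sum_u x u); last by rewrite PyS xS subrr.
    by rewrite -sumrB; apply: eq_bigr => u _; rewrite !ffunE.
  have cw : 0 <= c w.
    rewrite -(pmulr_lge0 _ wv); have [Py0 _ _] := Pfun _ yL; have := Py0 v.
    suff -> : lin_ext P y v = c w * P w v by [].
    transitivity (lin_ext P c v); first by rewrite cz !ffunE xv subr0.
    rewrite lin_extE (bigD1 w) //= big1 ?addr0 // => u uw.
    have [ur | /(suppP _ _ cr) ->] := boolP (u \in r'); last by rewrite mul0r.
    have uy : u \in supp y0 by move: ur; rewrite in_setU1 (negPf uw).
    by rewrite (suppP _ _ (Pt u uy)) ?mulr0 // !inE eqxx.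
  have [a a0 ha] := small_step y0 c.
  have [h [h0 ha' h1]] : exists h, [/\ 0 < h, h < a & h <= 1].
    exists (Num.min (a / 2) 1); rewrite lt_min divr_gt0 // ltr01.
    by split=> //; rewrite ?ge_min ?lexx ?orbT // gt_min; apply/orP; left; lra.
  have yc : polyhedron (powerset r') (y0 + h *: c).
    apply/polyhedron_powerset; split.
    - move=> u; rewrite !ffunE /GRing.scale /=.
      have [uy | uy] := boolP (u \in supp y0).
        by apply/ltW/ha; rewrite ?h0 // lt0r y00 andbT; move: uy; rewrite inE.
      have -> : y0 u = 0 by move: uy; rewrite inE negbK => /eqP.
      rewrite add0r; have [-> | uw] := eqVneq u w; first by rewrite mulr_ge0 // ltW.
      by rewrite (suppP _ _ cr) ?mulr0 // !inE negb_or uw /=; move: uy; rewrite inE.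
    - transitivity (\sum_u y0 u + h * \sum_u c u); last by rewrite y0S c1 mulr0 addr0.
      by rewrite mulr_sumr -big_split; apply: eq_bigr => u _; rewrite !ffunE.
    - apply/suppP => u ur; transitivity (y0 u + h * c u); first by rewrite !ffunE.
      by rewrite (suppP _ _ cr) // (suppP _ _ (subset_trans (subxx _) yr')) // mulr0 addr0.
  have y0q' : polyhedron (powerset q) y0 by apply/polyhedron_powerset.
  have h01 : 0 <= h <= 1 by rewrite ltW.
  have := triangulates_inj hP (polyhedron_face hL r'L yc)
    (polyhedron_face hL qL (polyhedron_convex h01 y0q' yq)).
  rewrite !lin_extD !lin_extZ lin_extB cz y0x => /(_ erefl).
  move=> /addrI/(scalerI (lt0r_neq0 h0)) cE.
  apply/suppP => u ur; have := suppP _ _ cr u ur; rewrite cE !ffunE.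
  by rewrite (suppP _ _ yr') // subr0.
(* Hence a ray in the sphere that starts at the image of [y0] begins inside the image of [r']. *)
have ray (d : coords R 'I_p.+2) a : 0 < a ->
    (forall e, 0 < e < a -> polyhedron (sphere p) (lin_ext Q y0 + e *: d)) ->
    exists e (y : coords R X), [/\ 0 < e, polyhedron (powerset r') y &
                    lin_ext Q y = lin_ext Q y0 + e *: d].
  move=> a0 ha; have [q [z0 [z1 [h [qL z0q z1q z0z [h0 z1z]]]]]] := ray_simplex hQ a0 ha.
  have zy : z0 = y0 := triangulates_inj hQ (polyhedron_face hL qL z0q) y0L z0z.
  rewrite zy in z0q; have [_ _ y0q] := (polyhedron_powerset _ _).1 z0q.
  exists h, z1; split=> //; have [? ? _] := (polyhedron_powerset _ _).1 z1q.
  by apply/polyhedron_powerset; split=> //; apply: local z1q.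
have [Y0 YS YK] := Qfun _ y0L.
have r'0 : r' != set0 by apply/set0Pn; exists w; rewrite !inE eqxx.
(* An interior point of [r'] lands in some facet of the sphere, and then all vertices of [r'] land
   in the same facet. *)
have [u Qu] : exists u, forall i, i \in r' -> Q i u = 0.
  have [b [br' bs _]] := exists_generic_point (fun w : X => vertex_point R w) r'0.
  have bL := polyhedron_face hL r'L br'.
  have [u bu] := sphere_coord0 (Qfun _ bL).
  by exists u => i; rewrite -bs; apply: triangulates_coord0 hQ bL bu.
have Qr' (y : coords R X) : polyhedron (powerset r') y -> lin_ext Q y u = 0.
  move=> /polyhedron_powerset[_ _ /suppP yr]; rewrite lin_extE big1 // => i _.
  by have [/Qu -> | /yr ->] := boolP (i \in r'); rewrite (mulr0, mul0r).
have Yu := Qr' _ y0r'.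
have [[u' u'u Yu'] | Yn] := pselect (exists2 u', u' != u & lin_ext Q y0 u' = 0).
  (* Moving in the direction from vertex [u1] to vertex [u] keeps coordinate [u'] zero, so it stays
     in the sphere; it makes coordinate [u] positive, which is impossible on [r']. *)
  have [u1 Yu1] : exists u1, 0 < lin_ext Q y0 u1.
    apply: contrapT => hn; have : \sum_i lin_ext Q y0 i = 0.
      apply: big1 => i _; apply/eqP; apply: contraT => Yi; case: hn; exists i.
      by rewrite lt0r Yi Y0.
    by rewrite YS => /eqP; rewrite oner_eq0.
  have u1u : u != u1 by apply: contraTneq Yu1 => <-; rewrite Yu ltxx.
  have u1u' : u' != u1 by apply: contraTneq Yu1 => <-; rewrite Yu' ltxx.
  have [e' | h [y [h0 yr yz]]] := ray (vertex_point R u - vertex_point R u1) _ Yu1.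
    move=> /andP[e'0 e'1]; apply: (@sphere_polyhedron _ _ _ u').
    - move=> i; rewrite !ffunE /GRing.scale /=.
      have [-> | _] := eqVneq i u1.
        by rewrite eq_sym (negPf u1u) sub0r mulrN1 subr_ge0 ltW.
      by rewrite subr0 addr_ge0 // mulr_ge0 ?ler0n // ltW.
    - transitivity (\sum_i lin_ext Q y0 i + e' * (\sum_i vertex_point R u i - \sum_i vertex_point R u1 i)).
        by rewrite -sumrB mulr_sumr -big_split; apply: eq_bigr => i _; rewrite !ffunE.
      by rewrite !sum_vertex_point subrr mulr0 addr0.
    - by rewrite !ffunE Yu' (negPf u'u) (negPf u1u') subrr scaler0 addr0.
  have := Qr' _ yr; rewrite yz !ffunE Yu eqxx (negPf u1u) subr0 add0r => /eqP.
  by rewrite /GRing.scale /= mulr1 gt_eqF.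
have Yp i : i != u -> 0 < lin_ext Q y0 i.
  by move=> iu; rewrite lt0r Y0 andbT; apply/eqP => Yi; apply: Yn; exists i.
(* Now only coordinate [u] vanishes, so a short step away from [Q w] stays in the facet. Inside [r']
   it would need a negative coefficient at [w], because [y0 w] is zero. *)
have [a a0 ha] := small_step (lin_ext Q y0) (lin_ext Q y0 - Q w).
have wr' : w \in r' by rewrite !inE eqxx.
have [_ QwS _] := triangulates_vertex hQ r'L wr'.
have [e' | h [y [h0 yr yz]]] := ray (lin_ext Q y0 - Q w) a a0.
  move=> e'a; apply: (@sphere_polyhedron _ _ _ u).
  - move=> i; have [-> | iu] := eqVneq i u.
      by rewrite !ffunE Yu Qu // subrr scaler0 addr0.
    rewrite ffunE [X in _ + X]ffunE; exact/ltW/ha/Yp.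
  - transitivity (\sum_i lin_ext Q y0 i + e' * (\sum_i lin_ext Q y0 i - \sum_i Q w i)).
      by rewrite -sumrB mulr_sumr -big_split; apply: eq_bigr => i _; rewrite !ffunE.
    by rewrite QwS YS subrr mulr0 addr0.
  - by rewrite !ffunE Yu Qu // subrr scaler0 addr0.
have [y_ge0 _ yu] := (polyhedron_powerset _ _).1 yr.
have : y - (y0 + h *: (y0 - vertex_point R w)) = 0.
  apply: (triangulates_indep hQ r'L).
    apply/suppP => i ir; rewrite !ffunE (suppP _ _ yu) // (suppP _ _ yr') //.
    have /negPf-> : i != w by apply: contraNneq ir => ->.
    by rewrite subrr scaler0 addr0 subrr.
  by rewrite lin_extB yz lin_extD lin_extZ lin_extB lin_ext_vertex subrr.
move/ffunP/(_ w); rewrite !ffunE y0w eqxx /GRing.scale /= => yw.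
have := y_ge0 w; lra.
Qed.

(** * A linear embedding of the join minus one simplex *)

Definition cone_simplex (n : nat) (x : 'I_3) (s : {set 'I_(2 * n).+1}) :
    {set 'I_(2 * n).+1 + 'I_3} :=
  inr x |: [set inl i | i in s].

(** Removing every simplex that contains the given one keeps the family closed under faces; for
    positive [n] and [#|s| = n] only the simplex itself is removed. *)
Definition join_minus_simplex (n : nat) (x : 'I_3) (s : {set 'I_(2 * n).+1}) :
    {set {set 'I_(2 * n).+1 + 'I_3}} :=
  join (Jcx n) (discrete_complex 'I_3)
  :\: [set r : {set 'I_(2 * n).+1 + 'I_3} | cone_simplex x s \subset r].

Lemma join_minus_simplexP n x (s : {set 'I_(2 * n).+1})
    (r : {set 'I_(2 * n).+1 + 'I_3}) : (0 < n)%N ->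
  reflect [/\ (#|[set i | inl i \in r]| <= n)%N, (#|[set k | inr k \in r]| <= 1)%N
            & ~~ (cone_simplex x s \subset r)]
          (r \in join_minus_simplex x s).
Proof.
move=> n0; rewrite !inE /= prednK //.
by apply: (iffP and3P) => -[? ? ?]; split.
Qed.

(* The [i]-th barycentric coordinate, with respect to the 2n-simplex, of the
   point [k].  In an affine dependency with coefficients [u], [v], [w] at [x],
   [y] and the third point, the coefficients at [a], at the vertices of [s] and
   at the remaining n vertices are positive multiples of [u/6 + 2v - w],
   [u/6 + v - w] and [-4u/3 - 4v + w]. *)
Definition apex_position (R : realType) (n : nat) (x y k : 'I_3)
    (s : {set 'I_(2 * n).+1}) (a i : 'I_(2 * n).+1) : R :=
  let c := n%:R^-1 in
  if i == a then if k == x then - 6^-1 else if k == y then -2 else 1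
  else if i \in s then if k == x then - 6^-1 * c else if k == y then - c else c
  else if k == x then 4 / 3 * c else if k == y then 4 * c else - c.

Lemma sum_apex (R : realType) (n : nat) (a : 'I_(2 * n).+1)
    (s : {set 'I_(2 * n).+1}) (b c d : R) :
  #|s| = n -> a \notin s ->
  \sum_i (if i == a then b else if i \in s then c else d) = b + n%:R * c + n%:R * d.
Proof.
move=> sn sa; rewrite (bigD1 a) //= eqxx -addrA; congr +%R.
rewrite (bigID (mem s)) /=; congr +%R.
  rewrite -[in RHS]sn mulr_natl -sumr_const; apply: eq_big => [i | i /andP[/negPf-> ->]//].
  by apply: andb_idl => si; apply: contraNneq sa => <-.
have cB : #|~: (a |: s)| = n.
  by rewrite cardsCs setCK card_ord cardsU1 sa sn; lia.
rewrite -[in RHS]cB mulr_natl -sumr_const; apply: eq_big => [i | i /andP[/negPf-> /negPf->] //].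
by rewrite !inE negb_or.
Qed.

Lemma sum_apex_position (R : realType) n x y k (s : {set 'I_(2 * n).+1}) a :
  (0 < n)%N -> #|s| = n -> a \notin s ->
  \sum_i apex_position R x y k s a i = 1.
Proof.
move=> n0 sn sa; have nR : n%:R != 0 :> R by rewrite pnatr_eq0 -lt0n.
rewrite sum_apex //; case: ifP => _; [|case: ifP => _]; by field.
Qed.

Lemma other_apices (x : 'I_3) : exists y z : 'I_3,
  [/\ y != x, z != x, z != y & forall k, [|| k == x, k == y | k == z]].
Proof.
by case: x => [[|[|[|//]]] h];
   [exists (@Ordinal 3 1 isT), (@Ordinal 3 2 isT) |
    exists (@Ordinal 3 0 isT), (@Ordinal 3 2 isT) |
    exists (@Ordinal 3 0 isT), (@Ordinal 3 1 isT)];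
   split=> // -[[|[|[|]]] ?].
Qed.

(** [x], [y], [z] are the coefficients of a dependency at the three apices; [a], [b], [c] are those
    at the vertices, up to positive factors. The conditions express, for the positive part ([e = 1])
    and the negative part ([e = -1]), the bound on the n+1 vertices [a |: s], that on the n+1
    vertices [~: s], the missing simplex, and the three pairs of apices. *)
Lemma balanced_signs (R : realFieldType) (x y z : R) :
  let a := x / 6 + 2 * y - z in
  let b := x / 6 + y - z in
  let c := - (4 / 3) * x - 4 * y + z in
  (forall e, [/\ 0 < e * a -> e * b <= 0, 0 < e * a -> e * c <= 0,
                 0 < e * x -> e * b <= 0 &
                 [/\ 0 < e * x -> e * y <= 0, 0 < e * x -> e * z <= 0 &
                     0 < e * y -> e * z <= 0]]) ->
  [/\ x = 0, y = 0 & z = 0].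
Proof.
move=> a b c.
(* Applied to the triple and to its negative, this yields [x = 0]. *)
have x_le0 (u v w : R) : let a := u / 6 + 2 * v - w in let b := u / 6 + v - w in
    let c := - (4 / 3) * u - 4 * v + w in
    (0 < u -> b <= 0) -> (0 < u -> v <= 0) -> (0 < u -> w <= 0) ->
    (v < 0 -> 0 <= w) -> (a < 0 -> 0 <= b) -> (a < 0 -> 0 <= c) -> u <= 0.
  move=> /= h1 h2 h3 h4 h5 h6; rewrite leNgt; apply/negP => u0.
  move: (h1 u0) (h2 u0) (h3 u0) => b0 v0 w0.
  have v_lt0 : v < 0 by lra.
  have w_ge0 := h4 v_lt0.
  have a0 : u / 6 + 2 * v - w < 0 by lra.
  have := h5 a0; have := h6 a0; lra.
move=> h; have [h1 h2 h3 [h4 h5 h6]] := h 1; have [k1 k2 k3 [k4 k5 k6]] := h (-1).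
rewrite !mul1r in h1 h2 h3 h4 h5 h6; rewrite !mulN1r !oppr_gt0 !oppr_le0 in k1 k2 k3 k4 k5 k6.
have xl : x <= 0 by apply: x_le0 h3 h4 h5 k6 k1 k2.
have xg : - x <= 0.
  apply: (x_le0 _ (- y) (- z)); rewrite /a /b /c in h1 h2 h3 k1 k2 k3 *.
  - by move=> x0; have := k3 ltac:(lra); lra.
  - by move=> x0; have := k4 ltac:(lra); lra.
  - by move=> x0; have := k5 ltac:(lra); lra.
  - by move=> y0; have := h6 ltac:(lra); lra.
  - by move=> a0; have := h1 ltac:(lra); lra.
  - by move=> a0; have := h2 ltac:(lra); lra.
have x0 : x = 0 by lra.
rewrite /a /b /c x0 in h1 k1.
case: (ltrgtP y 0) => y0.
- by have := k6 y0; have := k1 ltac:(have := k6 y0; lra); lra.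
- by have := h6 y0; have := h1 ltac:(have := h6 y0; lra); lra.
case: (ltrgtP z 0) => z0; last by [].
- by have := h1 ltac:(lra); lra.
- by have := k1 ltac:(lra); lra.
Qed.

Lemma join_minus_simplex_embedding (R : realType) n x (s : {set 'I_(2 * n).+1}) :
  (0 < n)%N -> #|s| = n ->
  exists P : 'I_(2 * n).+1 + 'I_3 -> 'rV[R]_(2 * n),
    set_inj (polyhedron (join_minus_simplex x s)) (lin_ext P).
Proof.
move=> n0 sn; have [y [z [yx zx zy xyz]]] := other_apices x.
have /set0Pn[a sa] : ~: s != set0.
  by rewrite -card_gt0 cardsCs setCK card_ord sn; lia.
rewrite inE in sa.
(* [q v] lists the 2n+1 barycentric coordinates of the position of [v]. They sum to 1, so the
   embedding may drop coordinate 0; [lq] recovers it for the dependency. *)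
pose q (v : 'I_(2 * n).+1 + 'I_3) i : R := match v with
  | inl j => (j == i)%:R | inr k => apex_position R x y k s a i end.
have q1 v : \sum_i q v i = 1.
  case: v => [j | k] /=; last exact: sum_apex_position.
  by rewrite (bigD1 j) //= eqxx big1 ?addr0 // => i /negPf; rewrite eq_sym => ->.
exists (fun v => \row_j q v (lift ord0 j)) => u v.
move=> /set_mem[u0 u1 uK] /set_mem[v0 v1 vK] uv.
pose l := u - v.
have lE w : l w = u w - v w by rewrite !ffunE.
have l1 : \sum_w l w = 0.
  by under eq_bigr do rewrite lE; rewrite sumrB u1 v1 subrr.
have lq0 j : \sum_w l w * q w (lift ord0 j) = 0.
  have /rowP/(_ j) : lin_ext (fun v => \row_j q v (lift ord0 j)) l = 0.
    by rewrite lin_extB uv subrr.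
  rewrite summxE mxE => h; apply: etrans h; apply: eq_bigr => w _.
  by rewrite !mxE.
have lq i : \sum_w l w * q w i = 0.
  have [j -> | ->] := unliftP ord0 i; first exact: lq0.
  have : \sum_i \sum_w l w * q w i = 0.
    by rewrite exchange_big /=; under eq_bigr do rewrite -mulr_sumr q1 mulr1.
  by rewrite big_ord_recl [X in _ + X]big1 ?addr0 // => j _; exact: lq0.
have sum3 (F : 'I_3 -> R) : \sum_k F k = F x + F y + F z.
  rewrite (bigD1 x) //= (bigD1 y) //= (big_pred1 z) ?addrA // => k /=.
  have := xyz k; have [-> _ | kz] := eqVneq k z; first by rewrite zx zy.
  by rewrite orbF => /orP[]/eqP->; rewrite eqxx ?andbF.
set wx := l (inr x); set wy := l (inr y); set wz := l (inr z).
have lI i : l (inl i) = - (wx * apex_position R x y x s a i +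
    wy * apex_position R x y y s a i + wz * apex_position R x y z s a i).
  have := lq i; rewrite big_sumType /= sum3 => /eqP; rewrite addrC addr_eq0.
  move=> /eqP ->; rewrite opprK (bigD1 i) //= eqxx mulr1 big1 ?addr0 //.
  by move=> j /negPf->; rewrite mulr0.
have la : l (inl a) = wx / 6 + 2 * wy - wz.
  rewrite lI /apex_position !eqxx (negPf yx) (negPf zx) (negPf zy); ring.
have nR : 0 < n%:R^-1 :> R by rewrite invr_gt0 ltr0n.
have ls i : i \in s -> l (inl i) = n%:R^-1 * (wx / 6 + wy - wz).
  move=> si; have /negPf ia : i != a by apply: contraNneq sa => <-.
  rewrite lI /apex_position si ia !eqxx (negPf yx) (negPf zx) (negPf zy); ring.
have lb i : i != a -> i \notin s ->
    l (inl i) = n%:R^-1 * (- (4 / 3) * wx - 4 * wy + wz).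
  move=> /negPf ia /negPf si.
  rewrite lI /apex_position si ia !eqxx (negPf yx) (negPf zx) (negPf zy); ring.
have supp_gt0 w : 0 < l w -> w \in supp u.
  by rewrite lE inE subr_gt0 => /(le_lt_trans (v0 w))/gt_eqF->.
have supp_lt0 w : l w < 0 -> w \in supp v.
  by rewrite lE inE subr_lt0 => /(le_lt_trans (u0 w))/gt_eqF->.
(* Positive coefficients of [l] sit in [supp u], negative ones in [supp v]; the sign of [e] selects
   one of these two simplices. *)
have excl e : exists2 t : coords R _, supp t \in join_minus_simplex x s &
    forall w, 0 < e * l w -> w \in supp t.
  have [e0 | e0] := lerP e 0; last by exists u => // w; rewrite pmulr_rgt0 //; exact: supp_gt0.
  exists v => // w elw; apply: supp_lt0; rewrite ltNge; apply: contraTN elw => lw.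
  by rewrite -leNgt mulr_le0_ge0.
have bound e (D : {set 'I_(2 * n).+1}) : #|D| = n.+1 ->
    ~ (forall i, i \in D -> 0 < e * l (inl i)).
  move=> Dn De; have [t /(join_minus_simplexP _ _ _ n0)[tn _ _] te] := excl e.
  move: tn; rewrite leqNgt -Dn => /negP; apply.
  by apply/subset_leq_card/subsetP => i /De/te it; rewrite in_set.
have apices e k k' : k != k' -> 0 < e * l (inr k) -> e * l (inr k') <= 0.
  move=> kk' ek; rewrite leNgt; apply/negP => ek'.
  have [t /(join_minus_simplexP _ _ _ n0)[_ tn _] te] := excl e.
  move: tn; rewrite leqNgt => /negP; apply.
  have kk2 : (2 <= #|[set k; k']|)%N by rewrite cards2 kk'.
  apply: leq_trans kk2 _; apply/subset_leq_card/subsetP => i.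
  by rewrite in_set2 in_set => /orP[]/eqP->; apply: te.
have asn : #|a |: s| = n.+1 by rewrite cardsU1 sa sn.
have scn : #|~: s| = n.+1 by rewrite cardsCs setCK card_ord sn; lia.
have [| wx0 wy0 wz0] := @balanced_signs _ wx wy wz.
  move=> e; split; last by split; apply: apices; rewrite // eq_sym.
  - move=> ea; rewrite leNgt; apply/negP => es; apply: (bound e _ asn) => i.
    rewrite in_setU1 => /orP[/eqP-> | /ls ->]; first by rewrite la.
    by rewrite mulrCA mulr_gt0.
  - move=> ea; rewrite leNgt; apply/negP => es; apply: (bound e _ scn) => i.
    rewrite inE => si; have [-> | ia] := eqVneq i a; first by rewrite la.
    by rewrite lb // mulrCA mulr_gt0.
  - move=> ex; rewrite leNgt; apply/negP => es.
    have [t /(join_minus_simplexP _ _ _ n0)[_ _ /negP tn] te] := excl e.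
    apply: tn; apply/subsetP => w; rewrite in_setU1 => /orP[/eqP-> | /imsetP[i si ->]].
      exact: te.
    by apply: te; rewrite ls // mulrCA mulr_gt0.
apply/subr0_eq/ffunP => -[i | k]; rewrite [RHS]ffunE -/l.
  by rewrite lI wx0 wy0 wz0 !mul0r !addr0 oppr0.
by case/or3P: (xyz k) => /eqP->.
Qed.

(** * Simplices of [Mcx] and disjoint pairs of spheres *)

Lemma card_sum_set (V W : finType) (r : {set V + W}) :
  #|r| = (#|[set v | inl v \in r]| + #|[set w | inr w \in r]|)%N.
Proof.
set A := [set v | inl v \in r]; set B := [set w | inr w \in r].
rewrite -(card_imset A (@inl_inj V W)) -(card_imset B (@inr_inj V W)) -cardsUI.
have -> : [set inl x | x in A] :&: [set inr x | x in B] = set0 :> {set V + W}.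
  apply/setP => x; rewrite in_setI in_set0; apply/negP => /andP[/imsetP[v _ ->]].
  by case/imsetP.
rewrite cards0 addn0; apply: eq_card => -[v | w]; rewrite in_setU.
  rewrite mem_imset ?in_set; last exact: inl_inj.
  by case: imsetP => [[? _ //] |]; rewrite orbF.
rewrite [X in _ || X]mem_imset ?in_set; last exact: inr_inj.
by case: imsetP => [[? _ //] |].
Qed.

Lemma cone_simplex_inl n x (s : {set 'I_(2 * n).+1}) :
  [set i | inl i \in cone_simplex x s] = s.
Proof. by apply/setP => i; rewrite in_set in_setU1 mem_imset //; exact: inl_inj. Qed.

Lemma cone_simplex_inr n x (s : {set 'I_(2 * n).+1}) :
  [set k | inr k \in cone_simplex x s] = [set x].
Proof.
apply/setP => k; rewrite in_set in_setU1 in_set1.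
by case: imsetP => [[? _ //] | _]; rewrite orbF.
Qed.

Lemma card_cone_simplex n x (s : {set 'I_(2 * n).+1}) :
  #|cone_simplex x s| = #|s|.+1.
Proof. by rewrite card_sum_set cone_simplex_inl cone_simplex_inr cards1 addn1. Qed.

Lemma sub_cone_simplex n x (s : {set 'I_(2 * n).+1}) (r : {set 'I_(2 * n).+1 + 'I_3}) :
  (forall i, inl i \in r -> i \in s) -> (forall k, inr k \in r -> k = x) ->
  r \subset cone_simplex x s.
Proof.
move=> rs rx; apply/subsetP => -[i /rs is_ | k /rx ->]; last by rewrite setU11.
by rewrite in_setU1 mem_imset ?is_ //; exact: inl_inj.
Qed.

Lemma McxP n (r : {set 'I_(2 * n).+1 + 'I_3}) : (0 < n)%N -> r \in Mcx n ->
  [/\ (#|[set i | inl i \in r]| <= n)%N, (#|[set k | inr k \in r]| <= 1)%N &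
      inr vertex_c \in r -> (#|[set i | inl i \in r]| < n)%N].
Proof.
move=> n0 /setDP[+ rM]; rewrite !inE /= prednK // => /andP[rn r1]; split=> // cr.
rewrite ltn_neqAle rn andbT; apply: contra rM => /eqP rI.
apply/imsetP; exists [set i | inl i \in r].
  by rewrite !inE /= prednK // rI leqnn eqxx.
have rA : [set k | inr k \in r] = [set vertex_c].
  by apply/eqP; rewrite eq_sym eqEcard sub1set in_set cr cards1.
apply/setP => -[i | k].
  by rewrite in_setU1 mem_imset ?in_set //; exact: inl_inj.
rewrite in_setU1; case: imsetP => [[? _ //] | _]; rewrite orbF.
by have /setP/(_ k) := rA; rewrite in_set in_set1 => ->.
Qed.

Lemma exists_superset_card (V : finType) (t : {set V}) k :
  (#|t| <= k <= #|V|)%N -> exists2 s : {set V}, t \subset s & #|s| = k.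
Proof.
move=> /andP[tk kV]; have [|u ut uk] := @exists_subset_card _ (~: t) (k - #|t|).
  by have := cardsC t; lia.
exists (t :|: u); first exact: subsetUl.
rewrite cardsU uk (_ : t :&: u = set0) ?cards0; first by lia.
by apply/eqP; rewrite setI_eq0 disjoint_sym -[t]setCK -subsets_disjoint.
Qed.

(** A missing simplex [m] extends to some x * s, which [N] then avoids. If c * t contained x * s,
    then [m], which lies in [Mcx n] while c * t does not, would be a proper face of c * t, so the
    boundary of c * t could not lie in [N]. *)
Lemma exists_avoiding_simplex n (N : {set {set 'I_(2 * n).+1 + 'I_3}}) :
  (0 < n)%N -> is_complex N -> N \proper Mcx n ->
  exists x (s : {set 'I_(2 * n).+1}), [/\ #|s| = n, N \subset join_minus_simplex x s &
    forall t : {set 'I_(2 * n).+1}, #|t| = n ->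
      (forall r : {set 'I_(2 * n).+1 + 'I_3},
         r \proper cone_simplex vertex_c t -> r \in N) ->
      cone_simplex vertex_c t \in join_minus_simplex x s].
Proof.
move=> n0 [_ hN] /properP[NM [m mM mN]]; have [mn m1 mc] := McxP n0 mM.
have [x mx] : exists x, forall k, inr k \in m -> k = x.
  have [m0 | /set0Pn[x xm]] := eqVneq [set k | inr k \in m] set0.
    (* A missing simplex without an apex may be coned from any of the three; [ord0] is an arbitrary
       choice. *)
    by exists ord0 => k km; have /setP/(_ k) := m0; rewrite in_set in_set0 km.
  by exists x => k km; apply: (card_le1_eqP m1); rewrite ?in_set // in_set in xm *.
have [|s ms sn] := @exists_superset_card _ [set i | inl i \in m] n.
  by rewrite mn card_ord; lia.
have mxs : m \subset cone_simplex x s.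
  by apply: sub_cone_simplex => // i im; apply: (subsetP ms); rewrite in_set.
exists x, s; split=> //.
  apply/subsetP => r rN; have [rn r1 _] := McxP n0 (subsetP NM r rN).
  apply/join_minus_simplexP => //; split=> //; apply: contra mN => xr.
  exact: hN rN (subset_trans mxs xr).
move=> t tn ht; apply/join_minus_simplexP => //.
rewrite cone_simplex_inl cone_simplex_inr tn cards1; split=> //.
apply: contra mN => xt; apply: ht; rewrite properEneq (subset_trans mxs xt) andbT.
apply: contraTneq mM => mE; apply/negP => /(McxP n0)[_ _].
by rewrite mE setU11 cone_simplex_inl tn ltnn => /(_ isT).
Qed.

Lemma linked_spheres (R : realType) n (N : {set {set 'I_(2 * n).+1 + 'I_3}}) l :
  (0 < n)%N -> N \subset Mcx n -> Lambda R n.-1 n N l ->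
  exists2 t : {set 'I_(2 * n).+1}, #|t| = n &
    forall r : {set 'I_(2 * n).+1 + 'I_3},
      (r \in l.1) = (r \proper cone_simplex vertex_c t).
Proof.
move=> n0 NM [[h1 l1N] [h2 l2N] l12 S1 S2]; have [_ d1] := h1; have [_ d2] := h2.
have M1 r : r \in l.1 -> r \in Mcx n by move=> /(subsetP l1N)/(subsetP NM).
have M2 r : r \in l.2 -> r \in Mcx n by move=> /(subsetP l2N)/(subsetP NM).
(* Having n+1 vertices forces n vertices of [J] and one apex, and in [Mcx n] this apex cannot be
   [vertex_c]. *)
have apex_lt r : r \in l.2 -> #|r| = n.+1 -> exists2 k, k != vertex_c &
    #|[set i | inl i \in r]| = n /\ [set k | inr k \in r] = [set k].
  move=> /M2/(McxP n0)[rn r1 rc] rE.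
  have {}rE : (#|[set i | inl i \in r]| + #|[set k | inr k \in r]|)%N = n.+1.
    by rewrite -rE [RHS]card_sum_set.
  have /eqP/cards1P[k rk] : #|[set k | inr k \in r]| = 1%N by lia.
  exists k; last by split=> //; lia.
  apply/eqP => kc; have := rc _; have /setP/(_ vertex_c) := rk.
  by rewrite in_set in_set1 kc eqxx => -> /(_ isT); rewrite rk cards1 in rE r1 *; lia.
have [r r2 rn] := PL_sphere_top_simplex h2 S2.
have [k kc [sn rk]] := apex_lt r r2 rn; set s := [set i | inl i \in r] in sn.
have kr : inr k \in r by have /setP/(_ k) := rk; rewrite in_set in_set1 eqxx.
have krE k' : inr k' \in r -> k' = k.
  by move=> k'r; have /setP/(_ k') := rk; rewrite in_set in_set1 k'r => /esym/eqP.
have card_swap v w : v \in r -> w \notin r -> #|w |: r :\ v| = n.+1.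
  move=> vr wr; rewrite cardsU1 in_setD1 (negPf wr) andbF.
  by have := cardsD1 v r; rewrite vr rn.
(* Exchanging a vertex of [s] brings in a further vertex [j] of [J]: a new apex is excluded because
   the apex [k] is still present. *)
have [j js jl] : exists2 j, j \notin s & [set inl j] \in l.2.
  have /set0Pn[i is_] : s != set0 by rewrite -card_gt0 sn.
  have ir : inl i \in r by rewrite in_set in is_.
  have [[j | k'] wr wl] := PL_sphere_no_free_face h2 S2 r2 rn ir.
    by exists j; [rewrite in_set | apply: d2 wl _; rewrite sub1set setU11].
  have [k1 _ [_ wk]] := apex_lt _ wl (card_swap _ _ ir wr).
  have k1E k2 : inr k2 \in inr k' |: r :\ inl i -> k2 = k1.
    by move=> k2r; have /setP/(_ k2) := wk; rewrite in_set in_set1 k2r => /esym/eqP.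
  have kk1 : k = k1 by apply: k1E; rewrite in_setU1 in_setD1 kr orbT.
  have kk' : k = k' by rewrite kk1; apply/esym/k1E; exact: setU11.
  by rewrite -kk' kr in wr.
have sl i : i \in j |: s -> [set inl i] \in l.2.
  rewrite in_setU1 => /orP[/eqP-> // |]; rewrite in_set => ir.
  by apply: d2 r2 _; rewrite sub1set.
(* Exchanging the apex [k] must bring in another apex different from [vertex_c], so both of these
   belong to [l.2]. *)
have al k' : k' != vertex_c -> [set inr k'] \in l.2.
  move=> k'c; have [[i | k''] wr wl] := PL_sphere_no_free_face h2 S2 r2 rn kr.
    have [k1 _ [_ wk]] := apex_lt _ wl (card_swap _ _ kr wr).
    have /setP/(_ k1) := wk; rewrite in_set in_set1 eqxx in_setU1 in_setD1 /=.
    by move=> /andP[/eqP kk1 /krE k1k]; rewrite k1k in kk1.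
  have [k1 k1c [_ wk]] := apex_lt _ wl (card_swap _ _ kr wr).
  have k''c : k'' != vertex_c.
    by have /setP/(_ k'') := wk; rewrite in_set in_set1 setU11 => /esym/eqP->.
  have k''k : k'' != k by apply: contraNneq wr => ->.
  have : (k' == k) || (k' == k'').
    have [y [z [_ _ _ yz]]] := other_apices vertex_c.
    move: (yz k) (yz k') (yz k''); rewrite (negPf kc) (negPf k'c) (negPf k''c) /=.
    move: k''k => /[swap] /orP[]/eqP-> /[swap] /orP[]/eqP-> /[swap] /orP[]/eqP->;
      by rewrite ?(eqxx y) ?(eqxx z) ?orbT.
  case/orP => /eqP->; first by apply: d2 r2 _; rewrite sub1set.
  by apply: d2 wl _; rewrite sub1set setU11.
have disj v : [set v] \in l.1 -> [set v] \in l.2 -> False.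
  move=> v1 v2; have : [set v] \in l.1 :&: l.2 by rewrite in_setI v1.
  by rewrite l12 in_set1 => /eqP/setP/(_ v); rewrite in_set1 eqxx in_set0.
have tn : #|~: (j |: s)| = n.
  by rewrite cardsCs setCK card_ord cardsU1 js sn; lia.
(* The vertices left for [l.1] are [vertex_c] and the n vertices of [J] outside [j |: s]. They span
   [q], which is not in [Mcx n], so [l.1] lies in the boundary of [q]. *)
exists (~: (j |: s)) => //; set q := cone_simplex _ _.
have qn : #|q| = n.+1 by rewrite card_cone_simplex tn.
have qM : q \notin Mcx n.
  apply/negP => /(McxP n0)[_ _]; rewrite cone_simplex_inl tn setU11 ltnn.
  by move/(_ isT).
have l1q u : u \in l.1 -> u \proper q.
  move=> ul; rewrite properEneq; apply/andP; split.
    by apply: contraTneq ul => ->; apply: contra qM; exact: M1.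
  have uv v : v \in u -> [set v] \in l.1 by move=> vu; apply: d1 ul _; rewrite sub1set.
  apply: sub_cone_simplex => [i iu | k' k'u].
    by rewrite in_setC; apply/negP => /sl; apply/disj/uv.
  by apply/eqP; apply: contraT => /al; case/disj; exact: uv.
have [t1 t1l t1n] := PL_sphere_top_simplex h1 S1; rewrite prednK // in t1n.
have t1q := l1q t1 t1l.
(* [t1] is the facet of [q] opposite to some [v0]. Exchanging a vertex [v] of [t1] within [q] can
   only bring in [v0], which gives the facet opposite to [v]. *)
have qD v : v \in q -> q :\ v \in l.1.
  have [v0 v0q v0t1] : exists2 v0, v0 \in q & v0 \notin t1.
    by case/properP: t1q => _ [v0]; exists v0.
  have qE : q = v0 |: t1.
    apply/esym/eqP; rewrite eqEcard subUset sub1set v0q (proper_sub t1q) /=.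
    by rewrite qn cardsU1 v0t1 t1n.
  have [-> _ | vv0] := eqVneq v v0; first by rewrite qE setU1K.
  rewrite {1}qE in_setU1 (negPf vv0) /= => vt1.
  have [w wt1 wl] := PL_sphere_no_free_face h1 S1 t1l (etrans t1n (esym (prednK n0))) vt1.
  have wq : w \in q by apply: (subsetP (proper_sub (l1q _ wl))); rewrite setU11.
  have wv0 : w = v0 by move: wq; rewrite qE in_setU1 (negPf wt1) orbF => /eqP.
  suff -> : q :\ v = w |: t1 :\ v by [].
  rewrite qE -wv0; apply/setP => u; rewrite !in_setD1 !in_setU1 in_setD1.
  by case: (eqVneq u w) => [-> | _] //=; rewrite wv0 eq_sym vv0.
move=> u; apply/idP/idP => [/l1q // | /properP[uq [v vq vu]]].
by apply: d1 (qD v vq) _; rewrite subsetD1 uq.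
Qed.

(** * Linear maps, disjoint simplices and the linking number *)

Lemma linear_subdivision_id (R : realType) (V : finType) (E : lmodType R)
    (K : {set {set V}}) (P : V -> E) :
  is_complex K ->
  linear_subdivision K (lin_ext P) K (@vertex_point R V).
Proof.
move=> hK; have E1 x := lin_ext_vertex_point (x : coords R V).
split.
  split=> //.
    split=> [x xK | x y _ _ | x xK]; rewrite ?E1 //.
    by exists x.
  by move=> s sK; exists s => // _ [x xs <-]; rewrite E1.
move=> x _; rewrite E1; apply: eq_bigr => v _.
by rewrite /= lin_ext_vertex.
Qed.

Lemma polyhedron_inj_disjoint (R : realType) (V : finType) (E : lmodType R)
    (K : {set {set V}}) (P : V -> E) (s t : {set V}) :
  set_inj (polyhedron (R := R) K) (lin_ext P) ->
  (forall r : {set V}, r \subset s -> r \in K) ->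
  (forall r : {set V}, r \subset t -> r \in K) ->
  [disjoint s & t] ->
  (geo_simplex P s `&` geo_simplex P t = classical_sets.set0)%classic.
Proof.
move=> hP sK tK st; rewrite -classical_sets.subset0 => _ [[x xs <-] [y yt yx]].
have [x0 x1 sx] := (polyhedron_powerset s x).1 xs.
have [y0 y1 ty] := (polyhedron_powerset t y).1 yt.
have xy : y = x.
  by apply: hP yx; apply: mem_set; split=> //; [exact: tK | exact: sK].
have : \sum_v x v = 0.
  apply: big1 => v _; have [vs | /(suppP _ _ sx) //] := boolP (v \in s).
  rewrite -xy; apply: (suppP _ _ ty).
  by rewrite (disjointFr st).
by rewrite x1 => /eqP; rewrite oner_eq0.
Qed.

Lemma boundary2_set1 (X : finType) (q : {set X}) :
  boundary2 [set q] = [set r : {set X} | (r \subset q) && (#|q| == #|r|.+1)].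
Proof.
apply/setP => r; rewrite !in_set.
have [rq | rq] := boolP ((r \subset q) && (#|q| == #|r|.+1)).
  have -> : [set s in [set q] | (r \subset s) && (#|s| == #|r|.+1)] = [set q].
    apply/setP => s; rewrite in_set in_set1.
    by case: (eqVneq s q) => // ->; rewrite rq.
  by rewrite cards1.
have -> : [set s in [set q] | (r \subset s) && (#|s| == #|r|.+1)] = set0.
  apply/setP => s; rewrite in_set in_set1 in_set0.
  by case: (eqVneq s q) => // ->; rewrite (negPf rq).
by rewrite cards0.
Qed.

Theorem proposition1p3 (R : realType) (n : nat)
    (N : {set {set ('I_(2 * n).+1 + 'I_3)}}) :
  (0 < n)%N -> is_complex N -> N \proper Mcx n ->
  exists f : coords R ('I_(2 * n).+1 + 'I_3)%type -> 'rV[R]_(2 * n),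
    PL_embedding N f /\
    forall l, Lambda R n.-1 n N l -> lk2 n.-1 n f l 0.
Proof.
move=> n0 hN NM; have [x [s [sn Ns hs]]] := exists_avoiding_simplex n0 hN NM.
have [P Pinj] := join_minus_simplex_embedding R x n0 sn.
have NK (z : coords R _) : polyhedron N z -> polyhedron (join_minus_simplex x s) z.
  by move=> [z0 z1 zN]; split=> //; apply: (subsetP Ns).
exists (lin_ext P); split.
  split; first by exists _, N, (@vertex_point R _); apply: linear_subdivision_id.
  move=> u v /set_mem/NK uK /set_mem/NK vK; apply: Pinj; exact: mem_set.
move=> l hl; have [t tn lE] := linked_spheres n0 (proper_sub NM) hl.
have [[h1 l1N] [h2 l2N] l12 _ _] := hl; have [_ d2] := h2.
set q := cone_simplex vertex_c t in lE.
have qn : #|q| = n.+1 by rewrite card_cone_simplex tn.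
(* The proper faces of [q] form [l.1] and so belong to [N]; the choice of [x] and [s] then keeps [q]
   in the embedded complex. *)
have qK : q \in join_minus_simplex x s.
  by apply: hs => // r rq; apply: (subsetP l1N); rewrite lE.
have Kd (r r' : {set 'I_(2 * n).+1 + 'I_3}) :
    r \in join_minus_simplex x s -> r' \subset r -> r' \in join_minus_simplex x s.
  move=> /(join_minus_simplexP _ _ _ n0)[rn r1 xr] r'r.
  apply/(join_minus_simplexP _ _ _ n0); split.
  - by apply: leq_trans rn; apply/subset_leq_card/subsetP => i; rewrite !in_set => /(subsetP r'r).
  - by apply: leq_trans r1; apply/subset_leq_card/subsetP => i; rewrite !in_set => /(subsetP r'r).
  - by apply: contra xr => xr'; apply: subset_trans r'r.
have PE : lin_ext P \o @vertex_point R _ = P.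
  by apply/funext => v; rewrite /= lin_ext_vertex.
have disj r : r \in simplices n l.2 ->
    (geo_simplex P q `&` geo_simplex P r = classical_sets.set0)%classic.
  rewrite in_set => /andP[rl _]; apply: (polyhedron_inj_disjoint Pinj).
  - by move=> r' /(Kd _ _ qK).
  - by move=> r' r'r; apply: (Kd r) => //; apply/(subsetP Ns)/(subsetP l2N).
  rewrite -setI_eq0; apply/eqP/setP => v; rewrite in_setI in_set0.
  apply/negP => /andP[vq vr].
  have : [set v] \in l.1 :&: l.2.
    rewrite in_setI lE (d2 r) ?sub1set // andbT properEcard sub1set vq cards1 qn.
    by rewrite ltnS.
  by rewrite l12 in_set1 => /eqP/setP/(_ v); rewrite in_set1 eqxx in_set0.
(* The single simplex [q] serves as the chain, and both spheres are their own subdivisions because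
   the map is linear. General position and the vanishing intersection number follow from
   disjointness. *)
exists _, [set q], P, _, l.2, (@vertex_point R _); rewrite PE; split.
- split.
  + by move=> r /set1P->; rewrite qn prednK.
  + move=> r /set1P-> u v /set_mem/polyhedron_powerset[u0 u1 uq].
    move=> /set_mem/polyhedron_powerset[v0 v1 vq].
    by apply: Pinj; apply: mem_set; split=> //; exact: Kd qK _.
  + exists _, l.1, (@vertex_point R _), id; split.
    * exact: linear_subdivision_id.
    * by move=> v _; rewrite lin_ext_vertex.
    * rewrite boundary2_set1; apply/setP => r.
      have -> : [set id @: (u : {set _}) | u in simplices n.-1 l.1] = simplices n.-1 l.1.
        by rewrite -[RHS]imset_id; apply: eq_imset => u; rewrite imset_id.
      rewrite !in_set lE prednK // qn eqSS properEcard qn.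
      by rewrite eq_sym -andbA; congr andb; case: eqP => [->|]; rewrite ?ltnSn ?andbF.
- exact: linear_subdivision_id.
- by move=> r r' /set1P-> /disj rr'; split; rewrite rr' => // ? ? [].
- apply/esym; rewrite /intersection2.
  rewrite (_ : [set _ | _] = set0) ?cards0 //.
  apply/setP => -[r r']; rewrite in_set in_set0 /= in_set1.
  apply/negP => /and3P[/eqP-> /disj rr'].
  by rewrite rr' => /asboolP[].
Qed.
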